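(* For every graph $G$ and every direction $f$ of $G$ the following assertions are equivalent: (i) The direction $f$ is countably determined in $G$. (ii) The direction $f$ is induced by a directional ray of $G$.
   Context: Graphs may be infinite of any cardinality. Countable means finite or countably infinite. A ray is a one-way infinite path; a tail of a ray is a subray. A direction of a graph $G$ is a map $f$ that assigns to every finite vertex set $X\subseteq V(G)$ a component $f(X)$ of $G-X$ such that $f(X)\supseteq f(X')$ whenever $X\subseteq X'$. Every ray $R\subseteq G$ induces a direction of $G$: the one sending each finite $X\subseteq V(G)$ to the unique component of $G-X$ that contains a tail of $R$. A directional choice in $G$ is a pair $(X,C)$ of a finite set $X\subseteq V(G)$ and a component $C$ of $G-X$. It distinguishes a direction $f$ from another direction $h$ if $f(X)=C$ and $h(X)\neq C$. A direction $f$ of $G$ is countably determined in $G$ if there is a countable set of directional choices in $G$ that distinguish $f$ from every other direction of $G$ (i.e. for every direction $h\ne f$ some directional choice in the set distinguishes $f$ from $h$). If $R\subseteq G$ is a ray, every finite initial segment of $R$, with vertex set $X$ say, defines the directional choice $(X,C)$ where $C$ is the component of $G-X$ that contains $R-X$. The ray $R$ is directional in $G$ if the direction induced by $R$ is distinguished from every other direction of $G$ by the directional choices defined by the finite initial segments of $R$. *)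

(* Defs.v *)
From Stdlib Require Import Relations.
From mathcomp Require Import all_boot.
From mathcomp Require Import boolp classical_sets functions cardinality.

Set Implicit Arguments.
Unset Strict Implicit.
Unset Printing Implicit Defensive.

Local Open Scope classical_set_scope.

Record graph := Graph {
  vertex :> Type;
  adj : vertex -> vertex -> Prop;
  adj_sym : forall u v, adj u v -> adj v u;
  adj_irrefl : forall u, ~ adj u u
}.

Record fvset (G : graph) := FVSet {
  fvset_set :> set G;
  fvset_finite : finite_set fvset_set
}.

(* [linked U x y]: there is a walk from x to y in the induced subgraph G[U]
   (the trivial walk if x = y). *)
Definition linked (G : graph) (U : set G) : G -> G -> Prop :=
  clos_refl_trans G (fun u v => [/\ U u, U v & adj u v]).

Definition connected_set (G : graph) (U : set G) : Prop :=
  U !=set0 /\ forall x y, U x -> U y -> linked U x y.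

(* The components of G - X are its maximal connected subgraphs; these are
   induced subgraphs, so they are represented by their vertex sets. *)
Definition component_minus (G : graph) (X C : set G) : Prop :=
  [/\ C `<=` ~` X, connected_set C &
      forall D : set G, D `<=` ~` X -> connected_set D -> C `<=` D -> D = C].

Record direction (G : graph) := Direction {
  dir_map :> fvset G -> set G;
  dir_component : forall X : fvset G, component_minus X (dir_map X);
  dir_mono : forall X X' : fvset G, X `<=` X' -> dir_map X' `<=` dir_map X
}.

Record ray (G : graph) := Ray {
  ray_vertex :> nat -> G;
  ray_inj : injective ray_vertex;
  ray_adj : forall n, adj (ray_vertex n) (ray_vertex n.+1)
}.

(* The tail of R starting at its n-th vertex is contained in the set C. *)
Definition tail_in (G : graph) (R : ray G) (n : nat) (C : set G) : Prop :=
  forall i, (n <= i)%N -> C (R i).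

Section InducedDirection.
Variable G : graph.
Implicit Types (X U C D : set G) (R : ray G).

Lemma linked_sub U U' x y : U `<=` U' -> linked U x y -> linked U' x y.
Proof.
move=> sUU'; elim=> [u v [Uu Uv uv]|u|u v w _ uv _ vw].
- by apply: rt_step; split => //; apply: sUU'.
- exact: rt_refl.
- exact: rt_trans uv vw.
Qed.

Lemma linked_sym U x y : linked U x y -> linked U y x.
Proof.
elim=> [u v [Uu Uv uv]|u|u v w _ uv _ vw].
- by apply: rt_step; split => //; apply: adj_sym.
- exact: rt_refl.
- exact: rt_trans vw uv.
Qed.

Lemma linked_in U x y : linked U x y -> U x -> U y.
Proof. by elim=> [u v []|//|u v w _ uv _ vw /uv/vw]. Qed.

Lemma linked_component X x :
  (~` X) x -> component_minus X [set y | linked (~` X) x y].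
Proof.
move=> Xx; set C := [set y | _].
have linkC y : C y -> linked C x y.
  rewrite /C /= => /(clos_rt_rtn1 G); elim=> [|u v [Xu Xv uv] xu IH].
    exact: rt_refl.
  have Cu : C u by exact: clos_rtn1_rt.
  apply: (rt_trans _ _ _ u) => //; apply: rt_step; split=> //.
  by apply: (rt_trans _ _ _ u) => //; apply: rt_step; split.
split.
- by move=> y xy; exact: linked_in xy Xx.
- split; first by exists x; exact: rt_refl.
  move=> y z /linkC xy /linkC xz; apply: rt_trans xz; exact: linked_sym.
- move=> D DX [_ cD] CD; apply/seteqP; split=> // y Dy.
  by apply: linked_sub DX _; apply: cD => //; apply: CD; exact: rt_refl.
Qed.

Lemma component_eq X C x :
  component_minus X C -> C x -> C = [set y | linked (~` X) x y].
Proof.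
move=> [CX [_ cC] maxC] Cx; have [sX cL _] := linked_component (CX _ Cx).
apply/esym/maxC => // y Cy; exact: linked_sub CX (cC _ _ Cx Cy).
Qed.

Lemma ray_tail_avoids R X :
  finite_set X -> exists n, tail_in R n (~` X).
Proof.
move=> /(finite_preimage (f := R)); case.
  by move=> i j _ _; exact: ray_inj.
move=> n fin; have /finite_seqP[s E] : finite_set (R @^-1` X) by exists n.
exists (\max_(i <- s) i).+1 => i lt_i Xi.
have si : i \in s by have : (R @^-1` X) i by []; rewrite E.
by move: lt_i; rewrite ltnNge (@leq_bigmax_seq _ s xpredT id i si isT).
Qed.

Lemma ray_tail_linked R n U : tail_in R n U ->
  tail_in R n [set y | linked U (R n) y].
Proof.
move=> RU i /subnKC <-; elim: (i - n)%N => [|k IH].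
  by rewrite addn0; exact: rt_refl.
apply: (rt_trans _ _ _ (R (n + k))) => //; rewrite addnS.
apply: rt_step; split; last exact: ray_adj.
- exact/RU/leq_addr.
- by apply: RU; rewrite -addnS leq_addr.
Qed.

Definition induces R (f : direction G) : Prop :=
  forall X : fvset G, exists n, tail_in R n (f X).

Lemma induced_direction_ex R : exists f, induces R f.
Proof.
have ex (X : fvset G) :
    exists C, component_minus X C /\ exists n, tail_in R n C.
  have [n RX] := ray_tail_avoids R (fvset_finite X).
  exists [set y | linked (~` X) (R n) y]; split.
    exact/linked_component/RX.
  by exists n; exact: ray_tail_linked.
pose F (X : fvset G) := sval (cid (ex X)).
have FC (X : fvset G) : component_minus X (F X) by exact: (svalP (cid (ex X))).1.
have FT (X : fvset G) : exists n, tail_in R n (F X) by exact: (svalP (cid (ex X))).2.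
have FM (X X' : fvset G) : X `<=` X' -> F X' `<=` F X.
  move=> sXX'; have [n Rn] := FT X; have [n' Rn'] := FT X'.
  have Fx := Rn _ (leq_maxl n n'); have F'x := Rn' _ (leq_maxr n n').
  rewrite (component_eq (FC X) Fx) (component_eq (FC X') F'x) => y.
  by apply: linked_sub => z + Xz; apply; exact: sXX'.
by exists (Direction FC FM).
Qed.

Lemma induced_direction_uniq R f g : induces R f -> induces R g -> f = g.
Proof.
move=> Rf Rg; have E : dir_map f = dir_map g.
  apply/funext => X; have [n Rn] := Rf X; have [m Rm] := Rg X.
  have fx := Rn _ (leq_maxl n m); have gx := Rm _ (leq_maxr n m).
  by rewrite (component_eq (dir_component f X) fx)
             (component_eq (dir_component g X) gx).
case: f g E {Rf Rg} => [f fC fM] [g gC gM] /= E; subst g.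
by congr Direction; exact: Prop_irrelevance.
Qed.

(* By [induced_direction_uniq], the only direction sending each X to a
   component of G - X that contains a tail of R. *)
Definition induced_direction R : direction G :=
  sval (cid (induced_direction_ex R)).

Lemma induced_directionP R : induces R (induced_direction R).
Proof. exact: svalP (cid (induced_direction_ex R)). Qed.

End InducedDirection.

Record directional_choice (G : graph) := DirectionalChoice {
  dc_set : fvset G;
  dc_comp : set G;
  dc_component : component_minus dc_set dc_comp
}.

Definition distinguishes (G : graph) (c : directional_choice G)
    (f h : direction G) : Prop :=
  f (dc_set c) = dc_comp c /\ h (dc_set c) <> dc_comp c.

Definition distinguishes_from_others (G : graph)
    (S : set (directional_choice G)) (f : direction G) : Prop :=
  forall h : direction G, h <> f -> exists2 c, S c & distinguishes c f h.

Definition countably_determined (G : graph) (f : direction G) : Prop :=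
  exists2 S : set (directional_choice G),
    countable S & distinguishes_from_others S f.

(* The initial segment of R with n.+1 vertices has vertex set
   X = {R 0, ..., R n}, and R - X is the tail of R starting at R n.+1. *)
Definition ray_choices (G : graph) (R : ray G) : set (directional_choice G) :=
  [set c | exists n, dc_set c = R @` `I_n.+1 :> set G
                     /\ tail_in R n.+1 (dc_comp c)].

Definition directional_ray (G : graph) (R : ray G) : Prop :=
  distinguishes_from_others (ray_choices R) (induced_direction R).

(* Main.v *)
From Stdlib Require Import Relations.
From mathcomp Require Import all_boot.
From mathcomp Require Import boolp classical_sets functions cardinality.
Require Import Defs.

Set Implicit Arguments.
Unset Strict Implicit.
Unset Printing Implicit Defensive.

Local Open Scope classical_set_scope.

(* Call a path or ray r_0 r_1 ... pursuing f if every r_k lies in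
   f({r_i | i < k}).  A finite path pursuing f can be prolonged along any simple
   path of f(r_0 ... r_n) towards a prescribed vertex x: while x stays in the
   component chosen by f, so does the rest of the simple path, so after finitely
   many steps either x has left that component or x itself has been visited.
   Hence for every countable set Q of vertices some ray R pursuing f has the
   property that each x in Q lies outside f(R_0 ... R_m) for some m.  Apply this
   to the union Q of the vertex sets of a countable set of choices determining f.
   For such a vertex set X, the component f(R_0 ... R_m) avoids X for large m, so
   any direction agreeing with f on the initial segments of R agrees with f on X.
   As R pursues f, its induced direction is one of these, and so equals f. *)

Lemma fvset_eq (G : graph) (X Y : fvset G) : X = Y :> set G -> X = Y.
Proof.
case: X Y => [X finX] [Y finY] /= E; subst Y.
by congr FVSet; exact: Prop_irrelevance.
Qed.

(** * Components and simple paths *)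

Section Components.
Variable G : graph.
Implicit Types (X U C D : set G).

Lemma component_linked X C x y :
  component_minus X C -> C x -> linked (~` X) x y -> C y.
Proof. by move=> CX Cx; rewrite (component_eq CX Cx). Qed.

Lemma component_eq_meet X C D x :
  component_minus X C -> component_minus X D -> C x -> D x -> C = D.
Proof.
by move=> CX DX Cx Dx; rewrite (component_eq CX Cx) (component_eq DX Dx).
Qed.

Lemma component_sup_meet X C D x : component_minus X C ->
  D `<=` ~` X -> connected_set D -> C x -> D x -> D `<=` C.
Proof.
move=> CX DX [_ cD] Cx Dx y Dy.
by apply: (component_linked CX Cx); exact: linked_sub DX (cD _ _ Dx Dy).
Qed.

End Components.

(** Deleting each vertex as it is left rules out repetitions. In [extends_along] this deletion keeps
    pace with the growth of the initial segment. *)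
Inductive simple_path (G : graph) : set G -> G -> G -> Prop :=
| simple_path_refl U x : U x -> simple_path U x x
| simple_path_step U x y z : U x -> adj x y ->
    simple_path (U `\ x) y z -> simple_path U x z.

Section SimplePaths.
Variable G : graph.
Implicit Types (U : set G).

Lemma simple_path_sub U V x y :
  U `<=` V -> simple_path U x y -> simple_path V x y.
Proof.
move=> sUV p; elim: p V sUV => {U x y} [U x Ux|U x y z Ux xy _ IH] V sUV.
  exact/simple_path_refl/sUV.
by apply: simple_path_step xy (IH _ _); [exact: sUV | exact: setSD].
Qed.

Lemma simple_path_linked U x y : simple_path U x y -> U x /\ linked U x y.
Proof.
elim=> {U x y} [U x Ux|U x y z Ux xy _ [[Uy _] yz]].
  by split=> //; exact: rt_refl.
split=> //; apply: (rt_trans _ _ _ y); first exact: rt_step.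
by apply: linked_sub yz => ? [].
Qed.

(** Cut the path at [a] if it meets [a]. This is the loop erasure that [linked_simple_path] performs
    when a walk returns to its first vertex. *)
Lemma simple_path_split U x y a : simple_path U x y -> U a ->
  simple_path U a y \/ simple_path (U `\ a) x y.
Proof.
move=> p; elim: p a => {U x y} [U x Ux|U x y z Ux xy p IH] a Ua.
  have [->|ax] := pselect (a = x); first by left; exact: simple_path_refl.
  by right; apply: simple_path_refl; split=> // /esym.
have [->|ax] := pselect (a = x).
  by left; exact: simple_path_step Ux xy p.
have [p'|p'] := IH a (conj Ua ax).
  by left; apply: simple_path_sub p' => ? [].
right; apply: simple_path_step xy _; first by split=> // /esym.
by apply: simple_path_sub p' => t [[Ut tx] ta].
Qed.

Lemma linked_simple_path U x y : linked U x y -> U x -> simple_path U x y.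
Proof.
move=> /(clos_rt_rt1n G); elim=> {x y} [x|x y z [_ Uy xy] _ IH] Ux.
  exact: simple_path_refl.
have [//|p] := simple_path_split (IH Uy) Ux.
exact: simple_path_step Ux xy p.
Qed.

End SimplePaths.

(** * Paths and rays pursuing a direction *)

Section Pursuit.
Variables (G : graph) (f : direction G).
Implicit Types (r : nat -> G) (X : fvset G).

Definition initial r k : fvset G := FVSet (finite_image r (finite_II k)).

Lemma initial_mono r k l : (k <= l)%N -> initial r k `<=` initial r l.
Proof. by move=> kl _ [i ik <-]; exists i => //=; exact: leq_trans kl. Qed.

Lemma initialS r k : initial r k.+1 `<=` initial r k `|` [set r k].
Proof.
move=> _ [i /= + <-]; rewrite ltnS leq_eqVlt => /orP[/eqP->|ik]; first by right.
by left; exists i.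
Qed.

Lemma eq_initial r r' k :
  (forall i, (i < k)%N -> r i = r' i) -> initial r k = initial r' k.
Proof.
move=> E; apply: fvset_eq; apply/seteqP; split=> _ [i /= ik <-]; exists i => //;
  by rewrite E.
Qed.

Lemma dir_avoids X : f X `<=` ~` X.
Proof. by have [] := dir_component f X. Qed.

Lemma dir_connected X : connected_set (f X).
Proof. by have [] := dir_component f X. Qed.

Lemma dir_step X x y : f X x -> adj x y -> (~` X) y -> f X y.
Proof.
move=> fx xy Xy; apply: (component_linked (dir_component f X) fx).
by apply: rt_step; split=> //; exact: (dir_avoids fx).
Qed.

(* A path in f X from f X' to v can leave f X' only through X', that is,
   only by stepping onto v. *)
Lemma dir_neighbour X X' v :
  X `<=` X' -> X' `<=` X `|` [set v] -> f X v -> (X' : set G) v ->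
  exists w, adj v w /\ f X' w.
Proof.
move=> sXX' X'X fv X'v; have [[y fy] _] := dir_connected X'.
have [_ /(_ y v (dir_mono sXX' fy) fv)] := dir_connected X.
move=> /(clos_rt_rtn1 G) yv; apply: contrapT => nw.
apply: (@dir_avoids X' v) X'v.
elim: yv => // u u' [_ fu' uu'] _ fu; apply: (dir_step fu uu').
move=> /X'X[/(dir_avoids fu')//|u'v]; apply: nw; exists u; split=> //.
by rewrite -u'v; exact: adj_sym.
Qed.

(** A finite path is encoded by a total function of which only the values up to [n] matter, so
    prolonging it never changes the type. *)
Definition pursues n r :=
  (forall k, (k <= n)%N -> f (initial r k) (r k)) /\
  (forall k, (k < n)%N -> adj (r k) (r k.+1)).

Lemma pursues_neighbour n r : pursues n r ->
  exists w, adj (r n) w /\ f (initial r n.+1) w.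
Proof.
move=> [fr _]; apply: (@dir_neighbour (initial r n)).
- exact: initial_mono.
- exact: initialS.
- exact: fr.
- by exists n => /=.
Qed.

Definition extends n r n' r' :=
  [/\ (n <= n')%N, forall i, (i <= n)%N -> r i = r' i & pursues n' r'].

Lemma extends_trans n r n1 r1 n2 r2 :
  extends n r n1 r1 -> extends n1 r1 n2 r2 -> extends n r n2 r2.
Proof.
move=> [le1 E1 _] [le2 E2 p2]; split=> //; first exact: leq_trans le2.
by move=> i le_i; rewrite E1 // E2 // (leq_trans le_i).
Qed.

Lemma extends_step n r w : pursues n r -> adj (r n) w ->
  f (initial r n.+1) w -> exists2 r', extends n r n.+1 r' & r' n.+1 = w.
Proof.
move=> [fr ar] rw fw; pose r' i := if (i <= n)%N then r i else w.
have r'E i : (i <= n)%N -> r' i = r i by rewrite /r' => ->.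
have r'n : r' n.+1 = w by rewrite /r' ltnn.
have initE k : (k <= n.+1)%N -> initial r' k = initial r k.
  by move=> kn; apply: eq_initial => i ik; apply: r'E; rewrite -ltnS (leq_trans ik).
exists r' => //; split=> [//|i /r'E //|]; split=> k.
  move=> kn; rewrite initE //; move: kn; rewrite leq_eqVlt => /orP[/eqP->|kn].
    by rewrite r'n.
  by rewrite r'E //; exact: fr.
rewrite ltnS => kn; rewrite r'E //; move: kn.
rewrite leq_eqVlt => /orP[/eqP->|kn]; first by rewrite r'n.
by rewrite r'E //; exact: ar.
Qed.

(** Induction on the simple path. As [U] avoids the initial segment, the path stays in the component
    of [x], so its next vertex [w] may be appended. Then [w] joins the initial segment and leaves
    [U], which restores the invariant. *)
Lemma extends_along U w x : simple_path U w x -> forall n r, pursues n r ->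
  adj (r n) w -> U `<=` ~` initial r n.+1 -> f (initial r n.+1) x ->
  exists n' r', [/\ (n < n')%N, extends n r n' r' & ~ f (initial r' n'.+1) x].
Proof.
move=> p; elim: p => {U w x} [U x Ux|U w y x Uw wy p IH] n r pr rw sU fx.
  have [r' er r'x] := extends_step pr rw fx.
  by exists n.+1, r'; split=> // /dir_avoids; apply; exists n.+1 => /=.
have fw : f (initial r n.+1) w.
  have [_ wx] := simple_path_linked (simple_path_step Uw wy p).
  apply: (component_linked (dir_component f _) fx).
  exact/linked_sym/(linked_sub sU wx).
have [r1 er1 r1n] := extends_step pr rw fw.
have [_ E1 pr1] := er1.
have [fx1|nfx1] := pselect (f (initial r1 n.+2) x); last by exists n.+1, r1.
have [| |n' [r' [lt_n' er' nfx']]] := IH n.+1 r1 pr1 _ _ fx1.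
- by rewrite r1n.
- move=> t [Ut tw] /initialS[|]; last by rewrite r1n.
  by rewrite -(eq_initial (r := r)) => [/(sU _ Ut)//|i]; exact: E1.
by exists n', r'; split=> //; [exact: ltnW | exact: extends_trans er1 er'].
Qed.

Lemma extends_excluding n r x : pursues n r ->
  exists n' r', [/\ (n < n')%N, extends n r n' r' & ~ f (initial r' n'.+1) x].
Proof.
move=> pr; have [w [rw fw]] := pursues_neighbour pr.
have [fx|nfx] := pselect (f (initial r n.+1) x).
  have [_ /(_ w x fw fx) wx] := dir_connected (initial r n.+1).
  apply: (extends_along (linked_simple_path wx fw) pr rw _ fx).
  exact: dir_avoids.
have [r' er _] := extends_step pr rw fw; have [_ E _] := er.
(* Once [x] is excluded it remains so, since the chosen components decrease; the one step only makes
   the path longer. *)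
exists n.+1, r'; split=> // /(dir_mono (initial_mono (leqnSn n.+1))).
by rewrite -(eq_initial (r := r)).
Qed.

Definition pursuing_ray (R : ray G) := forall n, f (initial R n) (R n).

Lemma pursuing_rayP r : (forall n, pursues n r) ->
  exists2 R : ray G, pursuing_ray R & R = r :> (nat -> G).
Proof.
move=> pr; have fr n : f (initial r n) (r n) by have [+ _] := pr n; apply.
(* Injectivity comes for free: [r j] lies in a component that avoids all earlier vertices. *)
have neq i j : (i < j)%N -> r i <> r j.
  by move=> ij E; apply: (dir_avoids (fr j)); exists i.
have inj : injective r.
  by move=> i j E; case: (ltngtP i j) => // /neq; rewrite E.
have ar n : adj (r n) (r n.+1) by have [_] := pr n.+1; apply.
by exists (Ray inj ar).
Qed.

(** Stage [i] of the recursion excludes the vertex of [Q] whose code under the injection [g] is [i],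
    if there is one. *)
Lemma exists_pursuing_ray (Q : set G) : countable Q ->
  exists2 R : ray G, pursuing_ray R &
    forall x, Q x -> exists m, ~ f (initial R m) x.
Proof.
move=> /countable_injP[g g_inj].
pose state := {s : nat * (nat -> G) | pursues s.1 s.2}.
pose next (i : nat) (s t : state) := [/\ ((sval s).1 < (sval t).1)%N,
  extends (sval s).1 (sval s).2 (sval t).1 (sval t).2 &
  forall x, Q x -> g x = i -> ~ f (initial (sval t).2 (sval t).1.+1) x].
have next_ex (p : nat * state) : exists t, next p.1 p.2 t.
  case: p => i [[n r] /= pr].
  have [[x [Qx gx]]|noQ] := pselect (exists x, Q x /\ g x = i).
    have [n' [r' [ltn er nfx]]] := extends_excluding x pr.
    have [_ _ pr'] := er; exists (exist _ (n', r') pr'); split=> //= y Qy gy.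
    by rewrite (g_inj y x) ?inE // gy gx.
  (* No vertex has code [i]: [r n] is a dummy target, used only to lengthen the path. *)
  have [n' [r' [ltn er _]]] := extends_excluding (r n) pr.
  have [_ _ pr'] := er; exists (exist _ (n', r') pr'); split=> //= y Qy gy.
  by case: noQ; exists y.
have [step stepP] := choice next_ex.
have [[v fv] _] := dir_connected (FVSet (finite_set0 G)).
have pv : pursues 0 (fun=> v).
  split=> // -[|//] _; have -> // : initial (fun=> v) 0 = FVSet (finite_set0 G).
  by apply: fvset_eq; apply/seteqP; split=> // ? [].
pose s := fix s i : state :=
  if i is j.+1 then step (j, s j) else exist _ (0, fun=> v) pv.
have sP i : next i (s i) (s i.+1) := stepP (i, s i).
pose N i := (sval (s i)).1; pose r i := (sval (s i)).2.
have prs i : pursues (N i) (r i) := svalP (s i).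
have ext i k : extends (N i) (r i) (N (i + k)) (r (i + k)).
  elim: k => [|k IH]; first by rewrite addn0.
  by rewrite addnS; apply: extends_trans IH _; have [] := sP (i + k).
have le_N i : (i <= N i)%N.
  by elim: i => // i IH; have [+ _ _] := sP i; exact: leq_ltn_trans.
(* The diagonal is the limit of the paths: [N i] is at least [i], so the [i]-th vertex is final from
   stage [i] on. *)
pose R i := r i i.
have RE i k : (k <= N i)%N -> R k = r i k.
  move=> kN; rewrite /R; have [ik|/ltnW ki] := leqP i k.
    by have [_ E _] := ext i (k - i); rewrite E // subnKC.
  by have [_ E _] := ext k (i - k); rewrite E // subnKC.
have prR n : pursues n R.
  have [fr ar] := prs n; split=> k kn.
    have kN : (k <= N n)%N := leq_trans kn (le_N n).
    rewrite (RE n) // (eq_initial (r' := r n)); first exact: fr.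
    by move=> i ik; apply: RE; exact: leq_trans (ltnW ik) kN.
  have kN : (k < N n)%N := leq_trans kn (le_N n).
  by rewrite !(RE n) //; [exact: ar | exact: ltnW].
have [R' fR' ER'] := pursuing_rayP prR.
exists R' => // x Qx; exists (N (g x).+1).+1; rewrite ER'.
have [_ _ /(_ x Qx erefl)] := sP (g x).
by rewrite -(eq_initial (r := R)) // => i; exact: RE.
Qed.

Lemma pursuing_ray_tail R n : pursuing_ray R -> tail_in R n (f (initial R n)).
Proof. by move=> fR i ni; apply: dir_mono (fR i); exact: initial_mono. Qed.

(** [X] is finite and the components decrease along [R], so the largest of the chosen indices
    excludes all of [X] at once. *)
Lemma dir_avoids_eventually R X :
  (forall x, (X : set G) x -> exists m, ~ f (initial R m) x) ->
  exists m, f (initial R m) `<=` ~` X.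
Proof.
move=> XR.
have [m mP] : {m : G -> nat & forall x, (X : set G) x -> ~ f (initial R (m x)) x}.
  apply: (choice (P := fun x m => (X : set G) x -> ~ f (initial R m) x)) => x.
  have [/XR[m fm]|nX] := pselect ((X : set G) x); first by exists m.
  by exists 0.
have /finite_seqP[s E] := finite_image m (fvset_finite X).
exists (\max_(i <- s) i) => x fx Xx; apply: (mP x Xx).
apply: dir_mono fx; apply: initial_mono.
have si : m x \in s by have : (m @` X) (m x) by [exists x]; rewrite E.
exact: (@leq_bigmax_seq _ s xpredT id _ si isT).
Qed.

End Pursuit.

(** * Agreement of directions, and the equivalence *)

Lemma agree_on_avoided (G : graph) (f h : direction G) (Y X : fvset G) :
  f Y `<=` ~` X -> h Y = f Y -> h X = f X.
Proof.
move=> fYX hY; have finZ : finite_set (Y `|` X).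
  by rewrite finite_setU; split; exact: fvset_finite.
pose Z := FVSet finZ.
have sYZ : Y `<=` Z by move=> ?; left.
have sXZ : X `<=` Z by move=> ?; right.
(* The connected set [f Y] avoids [X], so it lies in one component of [G - X]. That component is
   [g X], because the nonempty set [g Z] lies in both [g Y] and [g X]. This applies to [f] and to
   [h]. *)
have sub (g : direction G) : g Y = f Y -> f Y `<=` g X.
  move=> gY; have [[z gz] _] := dir_connected g Z.
  apply: (component_sup_meet (x := z) (dir_component g X)) => //.
  - exact: dir_connected.
  - exact: dir_mono sXZ _ gz.
  - by rewrite -gY; exact: dir_mono sYZ _ gz.
have [[z fz] _] := dir_connected f Y.
by apply: (component_eq_meet (x := z) (dir_component h X) (dir_component f X));
   exact: sub.
Qed.

Lemma countable_ray_choices (G : graph) (R : ray G) :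
  countable (ray_choices R).
Proof.
have [n nP] : {n : directional_choice G -> nat & forall c, ray_choices R c ->
    dc_set c = R @` `I_(n c).+1 :> set G /\ tail_in R (n c).+1 (dc_comp c)}.
  apply: (choice (P := fun c n => ray_choices R c ->
    dc_set c = R @` `I_n.+1 :> set G /\ tail_in R n.+1 (dc_comp c))) => c.
  have [[n nP]|nR] := pselect (ray_choices R c); first by exists n.
  by exists 0.
(* The length of the segment determines the choice: two components belonging to the same segment
   share the next vertex of [R]. *)
apply/countable_injP; exists n => c d; rewrite !inE => /nP[cX cT] /nP[dX dT] E.
move: cX cT dX dT; rewrite E; case: c d {E} => [X C CX] [Y D DY] /= XE CR YE DR.
have XY : X = Y by apply: fvset_eq; rewrite XE YE.
subst Y; have CD := component_eq_meet CX DY (CR _ (leqnn _)) (DR _ (leqnn _)).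
by subst D; congr DirectionalChoice; exact: Prop_irrelevance.
Qed.

Theorem theorem1 (G : graph) (f : direction G) :
  countably_determined f <->
  exists R : ray G, directional_ray R /\ f = induced_direction R.
Proof.
split=> [[S cS Sf]|[R [dR ->]]]; last first.
  by exists (ray_choices R) => //; exact: countable_ray_choices.
pose Q := \bigcup_(c in S) (dc_set c : set G).
have cQ : countable Q.
  by apply: bigcup_countable => // c _; exact/finite_set_countable/fvset_finite.
have [R fR QR] := exists_pursuing_ray f cQ.
(* Only nonempty initial segments are assumed here, since these are the ones occurring in
   [ray_choices]; hence the shift to [m.+1] below. *)
have agree (h : direction G) : (forall n, h (initial R n.+1) = f (initial R n.+1)) -> h = f.
  move=> hf; apply: contrapT => /Sf[c Sc [fc]]; apply; rewrite -fc.
  have [|m fm] := @dir_avoids_eventually _ f R (dc_set c).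
    by move=> x cx; apply: QR; exists c.
  apply: (agree_on_avoided (Y := initial R m.+1)); last exact: hf.
  by apply: subset_trans fm; apply: dir_mono; exact: initial_mono.
have fE : induced_direction R = f.
  apply: agree => n; have [m Rm] := induced_directionP R (initial R n.+1).
  apply: (component_eq_meet (x := R (maxn m n.+1)) (dir_component _ _)
            (dir_component _ _)).
    exact/Rm/leq_maxl.
  exact: pursuing_ray_tail fR _ (leq_maxr _ _).
exists R; split=> //; rewrite /directional_ray fE => h hf.
(* If no choice of [R] separates [h] from [f], then [h] agrees with [f] on all these segments. *)
apply: contrapT => nc; apply: hf; apply: agree => n; apply: contrapT => hn.
apply: nc; exists (DirectionalChoice (dir_component f (initial R n.+1))) => //.
by exists n; split=> //; exact: pursuing_ray_tail.
Qed.
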